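(* For every metric Peano continuum $X$, $$\mathsf{S}\text{-}\mathsf{Dim}(X)\le\text{Hö-Dim}(X)\le 2\cdot \mathsf{S}\text{-}\mathsf{Dim}(X).$$
   Context: A Hausdorff topological space $X$ is a Peano continuum if there is a surjective continuous map $[0,1]\to X$; a metric Peano continuum is a metric space whose topology makes it a Peano continuum. For a metric Peano continuum $X$ and $\varepsilon>0$, $S_X(\varepsilon)$ is the smallest cardinality of a cover of $X$ by connected subsets of diameter $\le\varepsilon$ (it is finite by a theorem of Sierpiński). The $S$-dimension is $\mathsf{S}\text{-}\mathsf{Dim}(X)=\limsup_{\varepsilon\to0}\frac{\ln S_X(\varepsilon)}{\ln(1/\varepsilon)}\in[0,\infty]$. For $\beta\ge 0$, a function $f:X\to Y$ between metric spaces is $\beta$-Hölder if there is a constant $C>0$ with $d_Y(f(x),f(x'))\le C\, d_X(x,x')^\beta$ for all $x,x'\in X$; every function to a bounded metric space is regarded as $0$-Hölder. The Hölder dimension is $\text{Hö-Dim}(X)=\inf\{\alpha\in(0,\infty]:\text{there is a surjective }\tfrac1\alpha\text{-Hölder function }f:[0,1]\to X\}$, where $\frac1\infty=0$. *)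

(* Defs.v *)
From HB Require Import structures.
From mathcomp Require Import all_boot all_order all_algebra.
From mathcomp Require Import all_classical all_reals all_analysis.
Import Order.TTheory GRing.Theory Num.Theory.
Import numFieldNormedType.Exports.

Set Implicit Arguments.
Unset Strict Implicit.
Unset Printing Implicit Defensive.

Local Open Scope classical_set_scope.
Local Open Scope ring_scope.

(* Maps out of [0, 1] are represented by maps f : R -> T of which only the
   values on `[0, 1] matter. *)
Definition peano_continuum (R : realType) (T : topologicalType) : Prop :=
  hausdorff_space T /\
  exists f : R -> T,
    {within `[0, 1], continuous f} /\ set_surj `[0, 1] [set: T] f.

Section SDimension.
Variables (R : realType) (X : metricType R).

(* Adding 0 only affects the empty set, whose diameter is 0. *)
Definition diameter (A : set X) : \bar R :=
  ereal_sup (0%E |` [set (mdist p.1 p.2)%:E | p in A `*` A]).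

Definition connected_cover (eps : R) (C : set (set X)) : Prop :=
  \bigcup_(A in C) A = [set: X] /\
  (forall A, C A -> connected A /\ (diameter A <= eps%:E)%E).

(* Equal to +oo when there is no finite cover; otherwise the infimum is over a
   nonempty set of natural numbers, hence a minimum. *)
Definition S_number (eps : R) : \bar R :=
  ereal_inf [set n%:R%:E | n in
    [set n : nat | exists C, connected_cover eps C /\ (C #= `I_n)%card]].

Definition S_dim : \bar R :=
  limf_esup (fun eps : R => lne (S_number eps) / (ln (1 / eps))%:E)%E 0^'+.

End SDimension.

(* As 0 `^ 0 = 1, for b = 0 the inequality reads mdist (f x) (f y) <= C, so that
   every function into a bounded space is 0-Hölder. *)
Definition holder_on (R : realType) (T U : metricType R) (b : R) (A : set T)
    (f : T -> U) : Prop :=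
  exists2 C : R, 0 < C &
    forall x y, A x -> A y -> mdist (f x) (f y) <= C * mdist x y `^ b.

(* In \bar R one has +oo^-1 = 0, so a = +oo gives the exponent 0. *)
Definition holder_dim (R : realType) (X : metricType R) : \bar R :=
  ereal_inf [set a : \bar R | (0 < a)%E /\
    exists f : R -> X,
      holder_on (T := R^o) (fine a^-1%E) (`[0, 1] : set R) f /\
      set_surj `[0, 1] [set: X] f].

(* Main.v *)
Require Import Defs.
From mathcomp Require Import all_boot all_order all_algebra.
From mathcomp Require Import all_classical all_reals all_analysis.
From mathcomp Require Import zify ring lra.
Import Order.TTheory GRing.Theory Num.Theory.
Import numFieldNormedType.Exports.

(* If f is surjective and 1/a-Hölder, the images of about eps^-a intervals of
   equal length cover X by connected sets of diameter at most eps, whence the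
   first inequality.

   For the second one, let al > 2 s > 2 S-Dim(X) and let N k = O(2^(k s)) be the
   number of sets in a cover of X by closed connected sets of diameter at most
   2^-k.  Two points of a set of the level-n cover are joined by a chain of
   sets of a fixed finest level M; refining chains level by level and erasing
   loops, one gets a chain that meets every set of every level k > n during a
   single interval of time, so that it changes of level-k set at most N k times.
   A closed walk through the sets of level n is turned into one through the sets
   of level n+1 by inserting, for each of the N (n+1) new sets, a round trip
   along such a chain.  The resulting walk changes of level-k set at most
   sum_(n < k) 2 N (n+1) (N k + 1) = O(k 2^(2 k s)) times, which is where the
   factor 2 comes from.  If every change of level-k set takes time 2^(- k al),
   the total time is bounded independently of M, and points at distance
   2^-k are separated by time at least a constant multiple of 2^(- k al).  An
   ultrafilter limit for M -> oo is a surjective 1/al-Hölder map. *)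

Set Implicit Arguments.
Unset Strict Implicit.
Unset Printing Implicit Defensive.

Local Open Scope classical_set_scope.

(** * Walks and chains *)

Section Changes.
Context {T : eqType} {K : eqType}.
Implicit Types (f : T -> K) (x y z : T) (p q : seq T).

Definition changes f x p : nat :=
  sumn (pairmap (fun a b => nat_of_bool (f a != f b)) x p).

Lemma changes_cat f x p q :
  changes f x (p ++ q) = (changes f x p + changes f (last x p) q)%N.
Proof. by rewrite /changes pairmap_cat sumn_cat. Qed.

Lemma changes_cons f x y p :
  changes f x (y :: p) = ((f x != f y) + changes f y p)%N.
Proof. by []. Qed.

Lemma changes_rcons f x p z :
  changes f x (rcons p z) = (changes f x p + (f (last x p) != f z))%N.
Proof. by rewrite -cats1 changes_cat /changes /= addn0. Qed.

Lemma changes_head f x y p : (changes f x p <= (f x != f y) + changes f y p)%N.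
Proof.
case: p => [|z p] //=; rewrite !changes_cons addnA leq_add2r.
by case: (f x =P f y) => [->|_] //=; case: (f x != f z); case: (f y != f z).
Qed.

Lemma changes_last f x p : ((f x != f (last x p)) <= changes f x p)%N.
Proof.
elim: p x => [|y p IHp] x /=; first by rewrite eqxx.
rewrite changes_cons; apply: leq_trans (leq_add (leqnn _) (IHp y)).
by case: (f x =P f y) => [->|_] //=; case: (f x != _).
Qed.

Lemma changes_subseq f x p q : subseq p q -> (changes f x p <= changes f x q)%N.
Proof.
elim: q x p => [|z q IHq] x [|y p] //=; case: eqP => [->|_] pq.
  by rewrite !changes_cons leq_add2l IHq.
apply: leq_trans (changes_head f x z _) _.
by rewrite [leqRHS]changes_cons leq_add2l IHq.
Qed.

Lemma changes_size f x p : (changes f x p <= size p)%N.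
Proof.
by elim: p x => [|y p IHp] x //=; rewrite changes_cons -add1n leq_add ?leq_b1.
Qed.

Lemma changes_const f x p : {in p, forall y, f y = f x} -> changes f x p = 0%N.
Proof.
elim: p x => [|y p IHp] x // fx;
  rewrite changes_cons fx ?mem_head // eqxx IHp //.
by move=> z zp; rewrite (fx y) ?mem_head // fx // inE zp orbT.
Qed.

Lemma changes_rev f x p :
  changes f (last x p) (rev (belast x p)) = changes f x p.
Proof.
elim: p x => [|y p IHp] x //=; rewrite rev_cons changes_rcons IHp changes_cons.
rewrite addnC; congr (nat_of_bool _ + _)%N; rewrite eq_sym.
by congr (_ != f _); case: p {IHp} => //= z p; rewrite rev_cons last_rcons.
Qed.

Lemma last_rev_belast x p : last (last x p) (rev (belast x p)) = x.
Proof. by case: p => //= y p; rewrite rev_cons last_rcons. Qed.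

(** Induction on the length: if the label of [x] recurs at a later vertex [y], everything up to [y]
    is dropped. The edges leaving a vertex depend only on its label, so what remains is a path from
    [x]. *)
Lemma loop_erasure (f : T -> K) (e : rel T) x p :
  (forall y z t, f y = f z -> e y t = e z t) -> path e x p ->
  exists q, [/\ subseq q p, path e x q, f (last x q) = f (last x p)
              & uniq (map f (x :: q))].
Proof.
move=> ef; have [n] := ubnP (size p); elim: n x p => // n IHn x p /ltnSE sp ep.
have [|xNp] := boolP (f x \in map f p).
  case/mapP => y /splitPr yp fxy; case: yp sp ep => p1 p2 sp ep.
  have [||q [qp2 eq lq uq]] := IHn x p2.
  - by move: sp; rewrite size_cat /=; lia.
  - by move: ep; rewrite cat_path /= => /and3P[_ _]; case: (p2) => //= z p3;
      rewrite (ef _ _ _ fxy).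
  exists q; split => //.
    by rewrite (subseq_trans qp2) // -cat_rcons suffix_subseq.
  by rewrite lq last_cat /=; case: (p2).
case: p => [|y p] in sp ep xNp *; first by exists [::].
have [||q [qp eq lq uq]] := IHn y p => //; first by case/andP: ep.
exists (y :: q); split => //=; first by rewrite eqxx.
- by rewrite eq andbT; case/andP: ep.
- move: uq => /= ->; rewrite andbT; apply: contra xNp.
  by apply: (@mem_subseq _ (map f (y :: q))); rewrite map_subseq //= eqxx.
Qed.

End Changes.

Lemma changes_map (T T' K : eqType) (f : T -> K) (g : T' -> T) x p :
  changes f (g x) (map g p) = changes (f \o g) x p.
Proof. by elim: p x => //= y p IHp x; rewrite !changes_cons IHp. Qed.

Definition overlap {T : Type} (V : nat -> set T) : rel nat :=
  fun i j => `[< V i `&` V j !=set0 >].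

Lemma overlap_sym {T : Type} (V : nat -> set T) : symmetric (overlap V).
Proof. by move=> i j; rewrite /overlap setIC. Qed.

(** The union [F] of the sets reached by a chain and the union [G] of the others are closed, being
    finite unions. On [A] they are complementary, so [F] is clopen in [A] and hence contains [A]. *)
Lemma connected_chain {T : topologicalType} (A : set T) (n : nat)
    (V : nat -> set T) (i j : nat) :
  connected A -> (forall x, A x -> exists2 l, (l < n)%N & V l x) ->
  (forall l, closed (V l)) -> (i < n)%N -> (j < n)%N ->
  A `&` V i !=set0 -> A `&` V j !=set0 ->
  exists p, [/\ path (overlap V) i p, last i p = j &
    {in i :: p, forall l, (l < n)%N /\ A `&` V l !=set0}].
Proof.
move=> cA AV clV ltin ltjn Ai Aj.
pose chain l := exists p, [/\ path (overlap V) i p, last i p = l &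
    {in i :: p, forall l, (l < n)%N /\ A `&` V l !=set0}].
have chain_i : chain i by exists [::]; split => // l; rewrite inE => /eqP ->.
have chain_step l m : chain l -> (m < n)%N -> A `&` V m !=set0 ->
    overlap V l m -> chain m.
  move=> [p [ep lp Pp]] mn Am olm; exists (rcons p m); split.
  - by rewrite rcons_path ep lp.
  - by rewrite last_rcons.
  - by move=> k; rewrite -rcons_cons mem_rcons inE => /predU1P[->//|/Pp].
pose F := \bigcup_(l in [set l | (l < n)%N /\ chain l]) V l.
pose G := \bigcup_(l in [set l | (l < n)%N /\ ~ chain l]) V l.
have fin (P : nat -> Prop) : finite_set [set l | (l < n)%N /\ P l].
  by apply: (sub_finite_set _ (finite_II n)) => l [].
have clF : closed F by apply: closed_bigcup => // *; exact: fin.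
have clG : closed G by apply: closed_bigcup => // *; exact: fin.
have AFE : A `&` F = A `&` ~` G.
  apply/seteqP; split => x [Ax Hx]; split => //.
    move=> [m [mn Nm] Vmx]; case: Hx => l [ln cl] Vlx; apply: Nm.
    by apply: (chain_step l) => //; [exists x|apply/asboolP; exists x].
  have [l ln Vlx] := AV x Ax; exists l => //; split => //.
  by apply: contrapT => Nl; apply: Hx; exists l.
have AF : A `&` F = A.
  apply: cA; first by case: Ai => x [Ax Vx]; exists x; split => //; exists i.
  - by exists (~` G) => //; rewrite openC.
  - by exists F.
have [x [Ax Vjx]] := Aj; have [_ [l [ln cl] Vlx]] : (A `&` F) x by rewrite AF.
by apply: (chain_step l) => //; apply/asboolP; exists x.
Qed.

(** * Refinement of chains through successive levels *)

Section Arcs.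
Context {T : topologicalType} (N : nat -> nat) (U : nat -> nat -> set T).
Hypotheses (Uclosed : forall k i, closed (U k i))
  (Uconn : forall k i, connected (U k i))
  (Ucover : forall k x, exists2 i, (i < N k)%N & U k i x).
Implicit Types (g h : nat -> nat) (p q : seq (nat -> nat)).

(** A vertex of a walk is a function [g] choosing for every level [k] the index [g k] of a set;
    adjacency reads only the label of level [m]. *)
Definition adjacent m : rel (nat -> nat) :=
  fun g h => overlap (U m) (g m) (h m).

Definition set_level m g j : nat -> nat := fun k => if k == m then j else g k.

Lemma set_level_eq m g j : set_level m g j m = j.
Proof. by rewrite /set_level eqxx. Qed.

Lemma set_level_neq m g j k : (k <= m)%N -> set_level m.+1 g j k = g k.
Proof. by rewrite /set_level; case: eqP => // ->; rewrite ltnn. Qed.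

Lemma path_set_level m g i s :
  path (adjacent m) (set_level m g i) (map (set_level m g) s) =
  path (overlap (U m)) i s.
Proof.
by elim: s i => //= j s IHs i; rewrite IHs /adjacent !set_level_eq.
Qed.

Definition refines m h p :=
  exists g j, [/\ g \in p, h = set_level m.+1 g j, (j < N m.+1)%N
                & U m (g m) `&` U m.+1 j !=set0].

Lemma refine_vertex m g x y : U m (g m) x -> U m (g m) y ->
  exists i s, [/\ path (adjacent m.+1) (set_level m.+1 g i)
                    (map (set_level m.+1 g) s),
    U m.+1 i x, U m.+1 (last i s) y,
    {in i :: s, forall j, refines m (set_level m.+1 g j) [:: g]} &
    forall k, (k <= m)%N ->
      changes (fun h => h k) (set_level m.+1 g i) (map (set_level m.+1 g) s)
      = 0%N].
Proof.
move=> gx gy; have [i iN Uix] := Ucover m.+1 x;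
  have [j jN Ujy] := Ucover m.+1 y.
have [|s [es ls Ps]] := @connected_chain T (U m (g m)) (N m.+1) (U m.+1) i j
  (@Uconn m (g m)) (fun z _ => Ucover m.+1 z) (@Uclosed m.+1) iN jN
  (ex_intro _ x (conj gx Uix)); first by exists y.
exists i, s; split; rewrite ?path_set_level ?ls //.
  by move=> l /Ps[lN Ul]; exists g, l; split; rewrite ?mem_head.
move=> k km; apply: changes_const => h /mapP[l _ ->].
by rewrite !set_level_neq.
Qed.

(** The refinements of two consecutive vertices are glued at a point [z] common to their sets of
    level [m]. A label of level at most [m] can then change only where the original path changes
    it. *)
Lemma refine_path m g p x y :
  path (adjacent m) g p -> U m (g m) x -> U m (last g p m) y ->
  exists i p', [/\ path (adjacent m.+1) (set_level m.+1 g i) p',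
    U m.+1 i x, U m.+1 (last (set_level m.+1 g i) p' m.+1) y,
    {in set_level m.+1 g i :: p', forall h, refines m h (g :: p)} &
    forall k, (k <= m)%N ->
      (changes (fun h => h k) (set_level m.+1 g i) p'
       <= changes (fun h => h k) g p)%N].
Proof.
elim: p g x => [|h p IHp] g x /=.
  move=> _ gx gy; have [i [s [es ix ly Ps cs]]] := refine_vertex gx gy.
  exists i, (map (set_level m.+1 g) s); split => //.
  - by rewrite last_map set_level_eq.
  - move=> h; rewrite -[_ :: _]/(map (set_level m.+1 g) (i :: s)).
    by case/mapP=> j js ->; exact: Ps.
  - by move=> k km; rewrite cs.
move=> /andP[/asboolP[z [gz hz]] ep] gx ly.
have [j [p' [ep' jz ly' Pp' cp']]] := IHp h z ep hz ly.
have [i [s [es ix lz Ps cs]]] := refine_vertex gx gz.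
exists i, (map (set_level m.+1 g) s ++ set_level m.+1 h j :: p'); split => //.
- rewrite cat_path es /= ep' andbT last_map /adjacent !set_level_eq.
  by apply/asboolP; exists z.
- by rewrite last_cat.
- move=> u; rewrite -cat_cons mem_cat => /orP[|/Pp'].
    rewrite -[_ :: _]/(map (set_level m.+1 g) (i :: s)) => /mapP[l ls ->].
    have [g' [j' [+ e jN U_]]] := Ps l ls; rewrite inE => /eqP gg'; subst g'.
    by exists g, j'; rewrite mem_head.
  by case=> g' [j' [g'hp e jN U_]]; exists g', j'; rewrite inE g'hp orbT.
- move=> k km; rewrite changes_cat cs // add0n last_map !changes_cons.
  by rewrite !set_level_neq // leq_add2l cp'.
Qed.

Definition nested n m h :=
  forall k, (n <= k < m)%N -> U k (h k) `&` U k.+1 (h k.+1) !=set0.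

(* Refining level by level and erasing loops at every level: an element of the
   cover of level k is visited during one interval of time, so there are at
   most [N k] changes of level-k element. *)
Lemma arc_exists n m a x y : (n <= m)%N -> U n a x -> U n a y ->
  exists g p, [/\ path (adjacent m) g p, U m (g m) x, U m (last g p m) y,
    {in g :: p, forall h, [/\ h n = a, nested n m h &
       forall k, (n < k <= m)%N -> (h k < N k)%N]} &
    forall k, (n < k <= m)%N -> (changes (fun h => h k) g p <= N k)%N].
Proof.
move=> nm ax ay; elim: m nm => [|m IHm].
  rewrite leqn0 => /eqP n0; subst n.
  exists (fun=> a), [::]; split => //= h.
  by rewrite inE => /eqP->; split => // -[].
rewrite leq_eqVlt => /predU1P[nm|].
  subst n; exists (fun=> a), [::]; split => //= h.
  rewrite inE => /eqP->; split=> // k /andP[km mk].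
    by move: (leq_ltn_trans km mk); rewrite ltnn.
  by move: (leq_trans km mk); rewrite ltnn.
rewrite ltnS => nm; have [g [p [ep gx ly Pp cp]]] := IHm nm.
have [i [p' [ep' ix ly' Pp' cp']]] := refine_path ep gx ly.
set g' := set_level m.+1 g i in ep' ly' Pp' cp'.
have [|q [qp eq lq uq]] := @loop_erasure _ _ (fun h => h m.+1) _ _ _ _ ep'.
  by move=> h h' h''; rewrite /adjacent => ->.
have qp' : {subset g' :: q <= g' :: p'}.
  by apply: mem_subseq; rewrite /= eqxx.
have Pq : {in g' :: q, forall h, [/\ h n = a, nested n m.+1 h &
    forall k, (n < k <= m.+1)%N -> (h k < N k)%N]}.
  move=> h /qp'/Pp'[u [j [up -> jN Uj]]]; have [ua nu bu] := Pp u up; split.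
  - by rewrite set_level_neq.
  - move=> k /andP[nk]; rewrite ltnS leq_eqVlt => /predU1P[->|km].
      by rewrite set_level_eq set_level_neq.
    rewrite (set_level_neq _ _ (ltnW km)) (set_level_neq _ _ km).
    by apply: nu; rewrite nk.
  - move=> k /andP[nk].
    rewrite leq_eqVlt => /predU1P[->|km]; first by rewrite set_level_eq.
    by rewrite set_level_neq //; apply: bu => //; rewrite nk.
exists g', q; split => //.
- by rewrite /g' set_level_eq.
- by rewrite lq.
- move=> k /andP[nk]; rewrite leq_eqVlt => /predU1P[->|km].
    (* After loop erasure the labels of level [m.+1] are distinct and below [N m.+1], which bounds
       the length of [q]. *)
    apply: leq_trans (changes_size _ _ _) _; apply: ltnW.
    rewrite -[_.+1](size_map (fun h => h m.+1) (g' :: q)) -(size_iota 0 (N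
      m.+1)).
    apply: uniq_leq_size => // j /mapP[h hq ->].
    rewrite mem_iota add0n /=; have [_ _ bq] := Pq h hq.
    by apply: bq; rewrite ltnS leqnn (leq_trans nm).
  apply: leq_trans (changes_subseq _ _ qp) _.
  by apply: leq_trans (cp' k km) _; apply: cp; rewrite nk.
Qed.

End Arcs.

Local Open Scope ring_scope.

(** * The walk through the sets of a given level *)

Section Walks.
Context {R : realType} {X : metricType R}.
Context (N : nat -> nat) (U : nat -> nat -> set X) (K : R).
Let D k : R := K / 2 ^+ k.
Hypotheses (Uclosed : forall k i, closed (U k i))
  (Uconn : forall k i, connected (U k i))
  (Unonempty : forall k i, U k i !=set0)
  (Ucover : forall k x, exists2 i, (i < N k)%N & U k i x)
  (Udiam : forall k i x y, U k i x -> U k i y -> mdist x y <= D k)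
  (N0 : N 0 = 1%N) (U0 : U 0%N 0%N = [set: X]).
Variable M : nat.
Implicit Types (g h z : nat -> nat) (p q : seq (nat -> nat)).

Let K_ge0 : 0 <= K.
Proof.
have [x Ux] := Unonempty 0 0.
by have := Udiam Ux Ux; rewrite mdistxx /D expr0 divr1.
Qed.

Let D_ge0 k : 0 <= D k. Proof. by rewrite /D divr_ge0 // exprn_ge0. Qed.

Let DS k : D k.+1 = D k / 2.
Proof. by rewrite /D exprSr invfM mulrA. Qed.

(** The term [2 * D k] is what nested labels give; each round of insertions at a level [i >= k] adds
    [2 * D i]. *)
Let bound k n : R := 2 * D k + \sum_(k <= i < n) 2 * D i.

Let boundS k n : (k <= n)%N -> bound k n.+1 = bound k n + 2 * D n.
Proof. by move=> kn; rewrite /bound big_nat_recr //= addrA. Qed.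

Let bound_geq k n : (n <= k)%N -> bound k n = 2 * D k.
Proof. by move=> nk; rewrite /bound big_geq // addr0. Qed.

Let bound_le k n : bound k n <= bound k n.+1.
Proof.
have [kn|nk] := leqP k n; last by rewrite !bound_geq // ltnW.
by rewrite boundS // lerDl mulr_ge0.
Qed.

Let bound_ub k n : bound k n <= 6 * D k.
Proof.
have [kn|nk] := leqP k n; last first.
  by rewrite bound_geq 1?ltnW //; have := D_ge0 k; lra.
suff -> : bound k n = 6 * D k - 4 * D n by have := D_ge0 n; lra.
elim: n kn => [|n IHn]; first by rewrite leqn0 => /eqP->;
  rewrite bound_geq //; ring.
rewrite leq_eqVlt => /predU1P[->|kn]; first by rewrite bound_geq //; ring.
by rewrite boundS // IHn // DS; field.
Qed.

(** Consecutive sets of levels [k] to [M] meet, so the distance is at most the geometric sum of the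
    diameter bounds, [2 * D k - D M]. *)
Lemma nested_close n h k u v : nested U n M h -> (n <= k <= M)%N ->
  U k (h k) u -> U M (h M) v -> mdist u v <= 2 * D k.
Proof.
move=> nh /andP[nk kM] hu hv.
suff: mdist u v <= 2 * D k - D M by have := D_ge0 M; lra.
have [d dE] : exists d, M = (k + d)%N by exists (M - k)%N; rewrite subnKC.
elim: d k nk kM dE u hu => [|d IHd] k nk kM dE u hu.
  have kE : k = M by rewrite dE addn0.
  by rewrite kE in hu *; have := Udiam hu hv; lra.
have kM' : (k < M)%N by rewrite dE; lia.
have [|x [x1 x2]] := nh k; first by rewrite nk.
have := IHd k.+1 (leqW nk) kM'; rewrite {1}dE addSnnS => /(_ erefl x x2).
have := Udiam hu x1; have := metric_triangle u x v; rewrite DS; lra.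
Qed.

(** Splicing labels destroys nestedness; what survives is that the set of level [k] stays close to
    the set of level [M]. *)
Definition tracked n h :=
  forall k u v, (k <= M)%N -> U k (h k) u -> U M (h M) v ->
  mdist u v <= bound k n.

Lemma trackedS n h : tracked n h -> tracked n.+1 h.
Proof.
by move=> th k u v kM hu hv; exact: le_trans (th k u v kM hu hv) (bound_le k n).
Qed.

Definition splice n z h : nat -> nat := fun k => if (k <= n)%N then z k else h
  k.

(** For levels at most [n], whose labels come from [z], the distance is measured through [w]: first
    tracking of [z], then nestedness of [h] from level [n] on, at the cost [2 * D n]. Above [n] the
    labels are those of the nested [h]. *)
Lemma splice_tracked n z h a w : (n < M)%N ->
  tracked n z -> U M (z M) w -> U n a w -> h n = a -> nested U n M h ->
  tracked n.+1 (splice n z h).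
Proof.
move=> nM tz zw aw hn nh k u v kM; rewrite /splice (leqNgt M) nM /=.
case: leqP => [kn|nk] hu hv; last first.
  by rewrite bound_geq //; apply: (nested_close nh); rewrite ?(ltnW nk).
have := tz k u w kM hu zw; have : mdist w v <= 2 * D n.
  by apply: (nested_close nh) hv; rewrite ?leqnn ?(ltnW nM) // hn.
by rewrite boundS //; have := metric_triangle u w v; lra.
Qed.

(* All points of the excursion inherit from [z] the labels of level at most
   [n], so that it only adds changes of the labels of level [k > n]. *)
Lemma insert_excursion n g p z a w y : (n < M)%N ->
  path (adjacent U M) g p -> {in g :: p, forall h, tracked n.+1 h} ->
  z \in g :: p -> tracked n z -> U M (z M) w -> U n a w -> U n a y ->
  exists p', [/\ path (adjacent U M) g p', {subset g :: p <= g :: p'},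
    {in g :: p', forall h, tracked n.+1 h},
    exists2 h, h \in g :: p' & U M (h M) y &
    forall k, (k <= M)%N -> (changes (fun h => h k) g p' <=
      changes (fun h => h k) g p + (n < k) * (2 * (N k).+1))%N].
Proof.
move=> nM ep tp zp tz zw aw ay.
have [F [eF tF [f fF fy] cF]] : exists F, [/\ path (adjacent U M) z F,
    {in F, forall h, tracked n.+1 h}, exists2 h, h \in F & U M (h M) y &
    forall k, (k <= M)%N ->
      (changes (fun h => h k) z F <= (n < k) * (N k).+1)%N].
  have [e [q [eq ew ly Pq cq]]] :=
    arc_exists Uclosed Uconn Ucover (ltnW nM) aw ay.
  have splM h : splice n z h M = h M by rewrite /splice leqNgt nM.
  (* The outward half: a jump from [z] to the start of the arc, which accounts for the successor in
     [(N k).+1], then the arc itself. *)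
  exists (map (splice n z) (e :: q)); split.
  - rewrite /= {1}/adjacent splM; apply/andP; split.
      by apply/asboolP; exists w.
    elim: q e eq {ew ly Pq cq} => //= h q IHq e /andP[eh /IHq ->].
    by rewrite andbT /adjacent !splM.
  - move=> _ /mapP[h hq ->]; have [ha nh _] := Pq h hq.
    exact: (splice_tracked nM tz zw aw ha nh).
  - exists (splice n z (last e q)); last by rewrite splM.
    by apply: map_f; exact: mem_last.
  - move=> k kM; have [kn|nk] := leqP k n.
      by rewrite changes_const // => _ /mapP[h _ ->]; rewrite /splice kn.
    rewrite mul1n /= changes_cons changes_map -add1n leq_add ?leq_b1 //.
    have -> : (fun h => h k) \o splice n z = fun h => h k.
      by apply/funext => h /=; rewrite /splice leqNgt nk.
    by apply: cq; rewrite nk.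
have sF : {subset rev (belast z F) <= z :: F}.
  by move=> h; rewrite mem_rev => /mem_belast.
case/splitPl: zp ep tp => p1 p2 lp1 ep tp.
(* The walk goes to [z], out along [F], back to [z] along the reversal of [F], and then resumes;
   hence the factor 2. *)
exists (p1 ++ (F ++ rev (belast z F)) ++ p2); split.
- move: ep; rewrite !cat_path !last_cat lp1 last_rev_belast => /andP[-> ->].
  rewrite eF andbT !andTb rev_path; apply: etrans eF.
  by apply: eq_path => h h'; rewrite /adjacent overlap_sym.
- move=> h; rewrite !inE !mem_cat.
  by move=> /orP[->//|/orP[->|->]]; rewrite ?orbT.
- have tp' h : (h == g) || (h \in p1) || (h \in p2) -> tracked n.+1 h.
    by move=> hp; apply: tp; rewrite inE mem_cat orbA.
  move=> h; rewrite inE !mem_cat => /orP[/eqP->|]; first by apply: tp';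
    rewrite eqxx.
  move=> /orP[hp|/orP[/orP[/tF//|/sF]|hp]].
  + by apply: tp'; rewrite hp orbT.
  + by rewrite inE => /predU1P[->|/tF//]; exact: trackedS.
  + by apply: tp'; rewrite hp orbT.
- by exists f => //; rewrite inE !mem_cat fF ?orbT.
- move=> k kM; rewrite !changes_cat !last_cat lp1 last_rev_belast changes_rev.
  by have := cF k kM; lia.
Qed.

(** Passing from level [j] to [j.+1] inserts [N j.+1] excursions, each of which affects only the
    labels of level [k > j]. *)
Definition max_changes k n : nat :=
  (\sum_(0 <= j < n) (j < k) * (N j.+1 * (2 * (N k).+1)))%N.

Let max_changesS k n : max_changes k n.+1 =
  (max_changes k n + (n < k) * (N n.+1 * (2 * (N k).+1)))%N.
Proof. by rewrite /max_changes big_nat_recr. Qed.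

Lemma walk_exists n : (n <= M)%N -> exists g p,
  [/\ path (adjacent U M) g p, {in g :: p, forall h, tracked n h},
    forall i, (i < N n)%N -> exists2 h, h \in g :: p &
      U M (h M) `&` U n i !=set0 &
    forall k, (k <= M)%N -> (changes (fun h => h k) g p <= max_changes k n)%N].
Proof.
elim: n => [|n IHn] nM.
  have [x _] := Unonempty 0 0.
  have [g gx] : exists g : nat -> nat, forall k, U k (g k) x.
    exists (fun k => projT1 (cid2 (Ucover k x))) => k.
    by case: cid2.
  exists g, [::]; split => //= [h|i].
    rewrite inE => /eqP-> k u v kM hu hv; rewrite bound_geq //.
    by apply: (@nested_close 0 g) hu hv => // j jM; exists x.
  rewrite N0 ltnS leqn0 => /eqP->; exists g; rewrite ?mem_head // U0 setIT.
  by exists x.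
have [g [p [ep tp vp cp]]] := IHn (ltnW nM).
suff step b : exists p', [/\ path (adjacent U M) g p',
    {subset g :: p <= g :: p'}, {in g :: p', forall h, tracked n.+1 h},
    forall i, (i < minn b (N n.+1))%N -> exists2 h, h \in g :: p' &
      U M (h M) `&` U n.+1 i !=set0 &
    forall k, (k <= M)%N -> (changes (fun h => h k) g p' <=
      max_changes k n + (n < k) * (b * (2 * (N k).+1)))%N].
  have [p' [ep' _ tp' vp' cp']] := step (N n.+1).
  exists g, p'; split => //; first by move=> i; rewrite -{1}(minnn (N n.+1));
    exact: vp'.
  by move=> k kM; rewrite max_changesS cp'.
elim: b => [|b [p' [ep' sp' tp' vp' cp']]].
  exists p; split => //; first by move=> h /tp; exact: trackedS.
    by move=> i; rewrite min0n.
  by move=> k kM; rewrite mul0n muln0 addn0 cp.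
have [y by_] := Unonempty n.+1 b.
have [a aN ay] := Ucover n y.
(* The excursion leaves from a vertex [z] of the walk built for level [n], where [tracked n] holds,
   and not from an earlier excursion; so the error grows only once per level. *)
have [z zp [w [zw aw]]] := vp a aN.
have [q [eq sq tq [h hq hy] cq]] :=
  insert_excursion nM ep' tp' (sp' z zp) (tp z zp) zw aw ay.
exists q; split => //.
- by move=> u /sp'/sq.
- move=> i; rewrite leq_min ltnS leq_eqVlt => /andP[/predU1P[->|ib] iN].
    by exists h => //; exists y.
  by have [|u /sq uq hu] := vp' i; [rewrite leq_min ib|exists u].
- move=> k kM; apply: leq_trans (cq k kM) _.
  by have := cp' k kM; case: (n < k)%N; lia.
Qed.

(** This forgets the labels: [y i] is a point of the finest set at index [i], and [c k i] counts the
    changes of the level-[k] label up to that index. *)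
Lemma walk_points : exists n (c : nat -> nat -> nat) (y : nat -> X),
  [/\ forall k, c k 0%N = 0%N,
      forall k, (k <= M)%N -> (c k n <= max_changes k M)%N &
      forall k i j, (i <= j <= n)%N -> (c k i <= c k j)%N] /\
  [/\ forall i, (i < n)%N -> mdist (y i) (y i.+1) <= 2 * D M,
      forall x, exists2 i, (i <= n)%N & mdist (y i) x <= 2 * D M &
      forall i j, (i <= j <= n)%N -> mdist (y i) (y j) <= D M \/
        exists k, [/\ (k < M)%N, (c k.+1 i < c k.+1 j)%N &
                    mdist (y i) (y j) <= 12 * D k]].
Proof.
have [g [p [ep tp vp cp]]] := walk_exists (leqnn M).
pose h i := last g (take i p).
have hp i : h i \in g :: p.
  have := mem_last g (take i p); rewrite !inE => /orP[->//|/mem_take ->].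
  by rewrite orbT.
pose y i := sval (cid (Unonempty M (h i M))).
have yP i : U M (h i M) (y i) by rewrite /y; case: cid.
pose c k i := changes (fun f => f k) g (take i p).
have cD k i j : (i <= j)%N ->
    (c k i + (h i k != h j k) <= c k j)%N.
  move=> ij; rewrite /c /h -(subnKC ij) takeD changes_cat leq_add2l last_cat.
  exact: (changes_last (fun f => f k)).
exists (size p), c, y; split; split => //.
- by move=> k; rewrite /c take0.
- by move=> k kM; rewrite /c take_size cp.
- by move=> k i j /andP[ij _]; apply: leq_trans (cD k i j ij); exact: leq_addr.
- move=> i ip; have : adjacent U M (h i) (h i.+1).
    move: ep; rewrite -{1}(cat_take_drop i p) (drop_nth g ip) cat_path /=.
    by rewrite /h (take_nth g ip) last_rcons => /and3P[].
  move=> /asboolP[x [x1 x2]]; have := metric_triangle (y i) x (y i.+1).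
  by have := Udiam (yP i) x1; have := Udiam x2 (yP i.+1); lra.
- move=> x; have [i iN Ux] := Ucover M x.
  have [f fp [z [fz iz]]] := vp i iN.
  have [p1 [p2 [pE lp]]] : exists p1 p2, p = p1 ++ p2 /\ last g p1 = f.
    by case/splitPl: fp => p1 p2 lp; exists p1, p2.
  exists (size p1); first by rewrite pE size_cat leq_addr.
  have hf : h (size p1) = f by rewrite /h pE take_size_cat.
  have := yP (size p1); rewrite {1}hf => /Udiam/(_ fz).
  by have := Udiam iz Ux; have := metric_triangle (y (size p1)) z x; lra.
- move=> i j /andP[ij jn].
  have [hM|hM] := eqVneq (h i M) (h j M).
    by left; apply: (@Udiam M (h i M)) => //; rewrite hM.
  right; have ex : exists k, h i k != h j k by exists M.
  (* [k.+1] is the first level at which the two labels differ; level 0 cannot occur, since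
     [max_changes] vanishes there. Both points are then within [6 * D k] of a point of their common
     set of level [k]. *)
  case: (ex_minnP ex) => -[|k] hk kmin.
    have := cD 0%N i j ij; rewrite hk.
    have : (c 0%N j <= c 0%N (size p))%N.
      by apply: leq_trans (cD _ _ _ jn); exact: leq_addr.
    have -> : c 0%N (size p) = 0%N.
      apply/eqP; rewrite -leqn0 /c take_size.
      by apply: leq_trans (cp 0%N (leq0n M)) _; rewrite /max_changes big1.
    by lia.
  exists k; have kM : (k < M)%N by exact: kmin.
  split => //; first by apply: leq_trans (cD _ _ _ ij); rewrite hk addn1.
  have hik : h i k = h j k.
    by apply/eqP/negPn/negP => /kmin; rewrite ltnn.
  have [u hu] := Unonempty k (h i k).
  have := tp _ (hp i) k u (y i) (ltnW kM) hu (yP i); rewrite hik in hu.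
  have := tp _ (hp j) k u (y j) (ltnW kM) hu (yP j).
  have := metric_triangle (y i) u (y j); rewrite (metric_sym (y i) u).
  by have := bound_ub k M; lra.
Qed.

End Walks.

(** * Parametrization of walks and passage to the limit *)

Lemma ultra_fmap {T T' : Type} (f : T -> T') (G : set_system T) :
  UltraFilter G -> UltraFilter (f @ G).
Proof.
move=> UG; split; first exact: fmap_proper_filter.
move=> H PH sGH; apply/seteqP; split => // A HA.
have [//|GA] := in_ultra_setVsetC (f @^-1` A) UG.
have HnA : H (~` A) by apply: sGH.
by have [x []] := filter_ex (filterI HA HnA).
Qed.

Section Limit.
Context {R : realType} {X : metricType R}.
Variables (C b : R).
Hypotheses (C_ge0 : 0 <= C) (b_gt0 : 0 < b).

Definition coarse_param (d : R) (f : R -> X) : Prop :=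
  (forall u v, 0 <= u -> u <= v -> v <= 1 ->
     mdist (f u) (f v) <= C * (v - u) `^ b + d) /\
  (forall x, exists2 u, 0 <= u <= 1 & mdist (f u) x <= d).

(** The map is a step function: at time [u] its value is [y i] for the last [i] with [t i <= u].
    Only [t i.+1] is known to exceed [u], so the step from [i] to [i.+1] is split off, which doubles
    the error. *)
Lemma step_param (n : nat) (t : nat -> R) (y : nat -> X) (d : R) :
  0 <= d -> t 0%N = 0 -> t n <= 1 ->
  (forall i j, (i <= j <= n)%N -> t i <= t j) ->
  (forall i, (i < n)%N -> mdist (y i) (y i.+1) <= d) ->
  (forall i j, (i <= j <= n)%N ->
     mdist (y i) (y j) <= C * (t j - t i) `^ b + d) ->
  (forall x, exists2 i, (i <= n)%N & mdist (y i) x <= d) ->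
  exists f, coarse_param (2 * d) f.
Proof.
move=> d0 t0 tn tmono ystep yhol ydense.
have idx u : {i : nat | 0 <= u ->
    [/\ (i <= n)%N, t i <= u & forall j, (j <= n)%N -> (i < j)%N -> u < t j]}.
  apply: cid; have [u0|] := boolP (0 <= u); last by exists 0%N.
  have ex : exists i, (i <= n)%N && (t i <= u) by exists 0%N; rewrite t0.
  have ub i : (i <= n)%N && (t i <= u) -> (i <= n)%N by case/andP.
  have [i /andP[iN tu] imax] := ex_maxnP ex ub.
  exists i => _; split => // j jn ij; rewrite ltNge; apply/negP => tj.
  by have := imax j; rewrite jn tj leqNgt ij => /(_ isT).
exists (fun u => y (sval (idx u))); split => [u v u0 uv v1|x].
  case: (idx u) => i /= /(_ u0)[iN tiu imax].
  case: (idx v) => j /= /(_ (le_trans u0 uv))[jn tjv jmax].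
  have ij : (i <= j)%N.
    by rewrite leqNgt; apply/negP => /(jmax _ iN); have := tiu; lra.
  have P0 : 0 <= C * (v - u) `^ b by rewrite mulr_ge0 ?powR_ge0.
  move: ij; rewrite leq_eqVlt => /predU1P[->|ij].
    by rewrite mdistxx; lra.
  have tSi := imax _ (leq_trans ij jn) (ltnSn i).
  have h1 := ystep i (leq_trans ij jn).
  have ijn : (i < j <= n)%N by rewrite ij.
  have h2 := yhol _ _ ijn; have h3 := metric_triangle (y i) (y i.+1) (y j).
  have h4 : (t j - t i.+1) `^ b <= (v - u) `^ b.
    apply: ge0_ler_powR; rewrite ?nnegrE ?(ltW b_gt0) //; last by lra.
      by rewrite subr_ge0 tmono.
    by lra.
  by have := ler_wpM2l C_ge0 h4; lra.
have [i iN yx] := ydense x; exists (t i).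
  have := tmono 0%N i; have := tmono i n; rewrite t0 !leqnn !iN /=.
  by move=> /(_ isT) tin /(_ isT) ->; rewrite (le_trans tin).
have ti0 : 0 <= t i by rewrite -t0 tmono.
(* Times may coincide, so the last index [j] at time [t i] may exceed [i]; but then [t j = t i] and
   the Hölder estimate puts [y j] within [d] of [y i]. *)
case: (idx (t i)) => j /= /(_ ti0)[jn tji jmax].
have ij : (i <= j)%N.
  by rewrite leqNgt; apply/negP => /(jmax _ iN); rewrite ltxx.
have ijn : (i <= j <= n)%N by rewrite ij.
have -> : 2 * d = d + d by ring.
apply: le_trans (metric_triangle _ (y i) _) _; apply: lerD => //.
rewrite metric_sym; have := yhol _ _ ijn.
have -> : t j = t i by apply/eqP; rewrite eq_le tji tmono.
by rewrite subrr powR0 ?gt_eqF // mulr0 add0r.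
Qed.

(** By compactness the maps converge pointwise along an ultrafilter containing the cofinite sets.
    For surjectivity, approximate preimages [w n] of [x] converge along it to some [u], and the
    uniform Hölder bound compares [F n (w n)] with [F n u]. *)
Lemma coarse_param_limit : compact [set: X] ->
  (forall d, 0 < d -> exists f, coarse_param d f) ->
  exists f : R -> X,
    (forall u v, 0 <= u -> u <= v -> v <= 1 ->
       mdist (f u) (f v) <= C * (v - u) `^ b) /\
    set_surj `[0, 1] [set: X] f.
Proof.
rewrite compact_ultra => cX cf.
have n0 (n : nat) : 0 < n.+1%:R^-1 :> R by rewrite invr_gt0.
pose F n := sval (cid (cf _ (n0 n))).
have FP n : coarse_param n.+1%:R^-1 (F n) by rewrite /F; case: cid.
have [G [UG sG]] := ultraFilterLemma eventually_filter.
have smallG e : 0 < e -> G [set n | n.+1%:R^-1 < e :> R].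
  by move=> e0; apply: sG; exact: (near_infty_natSinv_lt (PosNum e0)).
have lim u : exists x : X, forall e, 0 < e -> G [set n | mdist x (F n u) < e].
  have UGu := ultra_fmap (F ^~ u) UG.
  have [x [_ /cvg_ballP Fx]] := cX _ UGu filterT; exists x => e e0.
  by have := Fx e e0; rewrite ballEmdist.
pose f u := sval (cid (lim u)).
have fP u e : 0 < e -> G [set n | mdist (f u) (F n u) < e].
  by move=> e0; rewrite /f; case: cid => x /= /(_ e e0).
exists f; split => [u v u0 uv v1|x _].
  apply/ler_addgt0Pl => e e0.
  have e3 : 0 < e / 3 by rewrite divr_gt0.
  have [n [[fu fv] /= ns]] :=
    filter_ex (filterI (filterI (fP u _ e3) (fP v _ e3)) (smallG _ e3)).
  have [/(_ u v u0 uv v1) h _] := FP n.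
  have := metric_triangle (f u) (F n u) (f v).
  have := metric_triangle (F n u) (F n v) (f v).
  rewrite (metric_sym (F n v)); move: fu fv h ns => /=.
  move: n.+1%:R^-1 (C * _) => r s; lra.
have U n : {u : R | 0 <= u <= 1 & mdist (F n u) x <= n.+1%:R^-1}.
  by apply: cid2; have [_ /(_ x)] := FP n.
pose w n := s2val (U n).
have wP n : 0 <= w n <= 1 /\ mdist (F n (w n)) x <= n.+1%:R^-1.
  by rewrite /w; case: (U n).
have UGw := ultra_fmap w UG.
have cI : compact (`[0, 1] : set R) by exact: segment_compact.
move: cI; rewrite compact_ultra => /(_ _ UGw)[|u [u01 /cvg_ballP wu]].
  change (G (w @^-1` `[0, 1])); apply: filterE => n /=.
  by rewrite in_itv /=; case: (wP n).
exists u => //; apply/mdist_positivity/eqP; rewrite eq_le mdist_ge0 andbT.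
apply/ler_addgt0Pl => e e0; rewrite addr0.
have e4 : 0 < e / 4 by rewrite divr_gt0.
(* Chosen so that [C + 1] times the [b]-th power of [r] is [e / 4]; the [+ 1] allows [C = 0]. *)
pose r := (e / 4 / (C + 1)) `^ b^-1.
have C1 : 0 < C + 1 by rewrite ltr_wpDl.
have r0 : 0 < r by rewrite powR_gt0 // divr_gt0.
have [n [[fu wr] /= ns]] :=
  filter_ex (filterI (filterI (fP u _ e4) (wu _ r0)) (smallG _ e4)).
have [/andP[w0 w1] wx] := wP n; have [h _] := FP n.
move: u01 => /=; rewrite in_itv /= => /andP[u0 u1].
have hC s : 0 <= s -> s <= r -> C * s `^ b <= e / 4.
  move=> s0 sr; have : s `^ b <= r `^ b.
    by apply: ge0_ler_powR; rewrite ?nnegrE ?(ltW b_gt0) // ltW.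
  rewrite -powRrM mulVf ?gt_eqF // powRr1 ?(ltW (divr_gt0 e4 C1)) // => sb.
  apply: (@le_trans _ _ ((C + 1) * s `^ b)).
    by rewrite ler_wpM2r ?powR_ge0 // lerDl.
  by rewrite mulrC -ler_pdivlMr.
have hw : mdist (F n u) (F n (w n)) <= e / 4 + e / 4.
  move: wr => /=; rewrite /ball /= => wr.
  have [uw|wu'] := leP u (w n).
    apply: le_trans (h _ _ u0 uw w1) _; apply: lerD; last exact: ltW.
    by apply: hC; [rewrite subr_ge0|move: wr; rewrite ler0_norm => [wr|]; lra].
  rewrite metric_sym; apply: le_trans (h _ _ w0 (ltW wu') u1) _.
  apply: lerD; last exact: ltW.
  by apply: hC; [rewrite subr_ge0 ltW|move: wr; rewrite gtr0_norm => [wr|];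
    lra].
have := metric_triangle (f u) (F n u) x.
have := metric_triangle (F n u) (F n (w n)) x.
by move: fu wx ns hw => /=; move: n.+1%:R^-1 => s; lra.
Qed.

End Limit.

(** * From covers of exponential size to a Hölder parametrization *)

Section HolderOfCovers.
Context {R : realType}.

(** Multiplied by the square of [1 - r], the partial sum has a closed form: [r] minus a nonnegative
    term. *)
Lemma sum_arith_geometric (r : R) n : 0 <= r < 1 ->
  \sum_(0 <= k < n) k%:R * r ^+ k <= r / (1 - r) ^+ 2.
Proof.
move=> /andP[r0 r1]; have r1' : 0 < 1 - r by rewrite subr_gt0.
have sumE m : (\sum_(0 <= k < m.+1) k%:R * r ^+ k) * (1 - r) ^+ 2 =
    r - r ^+ m.+1 * (m.+1%:R - m%:R * r).
  elim: m => [|m IHm]; first by rewrite big_nat1 !mul0r subr0 mulr1 subrr.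
  by rewrite big_nat_recr //= mulrDl IHm -![in LHS]natr1 -![in RHS]natr1
    !exprS; ring.
rewrite ler_pdivlMr ?exprn_gt0 //; case: n => [|n].
  by rewrite big_geq // mul0r.
rewrite sumE gerBl mulr_ge0 ?exprn_ge0 // subr_ge0 -natr1.
by have := ler_piMr (ler0n R n) (ltW r1); lra.
Qed.

(** Only indices [j < k] contribute, each with a product of two counts of order [a ^+ k]; this
    square is the origin of the factor 2 between the dimensions. *)
Lemma max_changes_le (N : nat -> nat) (L a : R) k n : 1 <= L -> 1 <= a ->
  (forall j, (N j)%:R <= L * a ^+ j) ->
  (max_changes N k n)%:R <= k%:R * (4 * L ^+ 2 * (a ^+ 2) ^+ k).
Proof.
move=> L1 a1 NL.
have a0 : 0 <= a by lra.
have L0 : 0 <= L by lra.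
have ak1 : 1 <= a ^+ k by exact: exprn_ege1.
have Lak1 : 1 <= L * a ^+ k by rewrite -[1]mulr1 ler_pM.
pose B := 4 * L ^+ 2 * (a ^+ 2) ^+ k.
have B0 : 0 <= B by rewrite !mulr_ge0 ?exprn_ge0 ?sqr_ge0.
apply: (@le_trans _ _ (\sum_(0 <= j < n) (j < k)%N%:R * B)).
  rewrite /max_changes natr_sum; apply: ler_sum_nat => j _.
  case: ltnP => jk; last by rewrite mul0n mul0r.
  rewrite !mul1n mul1r natrM natrM -(natr1 (N k)).
  have -> : B = (L * a ^+ k) * (2 * (L * a ^+ k + L * a ^+ k)).
    by rewrite /B -exprM mulnC exprM; ring.
  apply: ler_pM => //.
    apply: le_trans (NL j.+1) _; rewrite ler_wpM2l ?ler_weXn2l //; lra.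
  by rewrite ler_wpM2l // lerD.
rewrite -mulr_suml ler_wpM2r // -natr_sum ler_nat.
suff -> : (\sum_(0 <= j < n) (j < k))%N = minn n k by rewrite geq_minr.
elim: n => [|n IHn]; first by rewrite big_geq // min0n.
by rewrite big_nat_recr //= IHn; lia.
Qed.

Theorem holder_of_covers (X : metricType R) (N : nat -> nat)
    (U : nat -> nat -> set X) (K L s al : R) :
  compact [set: X] ->
  (forall k i, closed (U k i)) -> (forall k i, connected (U k i)) ->
  (forall k i, U k i !=set0) ->
  (forall k x, exists2 i, (i < N k)%N & U k i x) ->
  (forall k i x y, U k i x -> U k i y -> mdist x y <= K / 2 ^+ k) ->
  N 0 = 1%N -> U 0%N 0%N = [set: X] ->
  1 <= L -> 0 <= s -> 2 * s < al ->
  (forall k, (N k)%:R <= L * (2 `^ s) ^+ k) ->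
  exists f : R -> X, holder_on (T := R^o) al^-1 `[0, 1] f /\
    set_surj `[0, 1] [set: X] f.
Proof.
move=> cX Ucl Uco Une Ucov Udiam N0 U0 L1 s0 s_al NL.
have al0 : 0 < al by lra.
have K0 : 0 <= K.
  have [x Ux] := Une 0%N 0%N.
  by have := Udiam _ _ _ _ Ux Ux; rewrite mdistxx expr0 divr1.
(* [b ^+ k] is the time, before rescaling, of one change of level-[k] label; [2 * s < al] gives
   [r < 1], which makes the total time converge. *)
pose a : R := 2 `^ s; pose b : R := 2 `^ (- al); pose r := b * a ^+ 2.
have a1 : 1 <= a by rewrite -[1](powRr0 2) ler_powR // ler1n.
have b0 : 0 < b by rewrite powR_gt0.
have r01 : 0 <= r < 1.
  rewrite mulr_ge0 ?sqr_ge0 ?ltW //= /r /b /a /powR pnatr_eq0 /= expr2 -!expRD.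
  rewrite -[ltRHS]expR0 ltr_expR -!mulrDl pmulr_llt0 ?ln_gt0 ?ltr1n //; lra.
have bk k : (b ^+ k) `^ al^-1 = (2 ^+ k)^-1.
  rewrite /b -powR_mulrn ?powR_ge0 // -!powRrM.
  by rewrite mulNr mulrC divfK ?gt_eqF // powRN powR_mulrn.
have {}NL k : (N k)%:R <= L * a ^+ k by exact: NL.
have rE : r = b * a ^+ 2 by [].
clearbody r b a.
pose T := 4 * L ^+ 2 * (r / (1 - r) ^+ 2) + 1.
have T0 : 0 < T.
  case/andP: r01 => r0 r1.
  by rewrite ltr_wpDl // !mulr_ge0 ?invr_ge0 ?sqr_ge0 //; lra.
(* The 24 is twice the 12 of [walk_points], because a distance of order [D k] is paid for by a
   change at level [k.+1]. The power of [T] undoes the rescaling of time to the unit interval. *)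
pose C := 24 * K * T `^ al^-1.
have C0 : 0 <= C by rewrite !mulr_ge0 ?powR_ge0.
have ial0 : 0 < al^-1 by rewrite invr_gt0.
have [|f [fH fS]] := coarse_param_limit C0 ial0 cX.
  move=> d d0.
  (* [step_param] doubles the mesh [2 * (K / 2 ^+ M)], hence the factor 4. *)
  have [M KM] : exists M : nat, 4 * K / 2 ^+ M <= d.
    exists (Num.bound (4 * K / d)).
    rewrite ler_pdivrMr ?exprn_gt0 // [leRHS]mulrC -ler_pdivrMr //.
    by apply/ltW/upper_nthrootP.
  have [n [c [y [[c0 cn cmono] [ystep ydense yd]]]]] :=
    walk_points Ucl Uco Une Ucov Udiam N0 U0 M.
  pose w i : R := \sum_(0 <= k < M.+1) b ^+ k * (c k i)%:R.
  have w_le i j : (i <= j <= n)%N -> w i <= w j.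
    move=> ij; apply: ler_sum => k _; rewrite ler_wpM2l ?exprn_ge0 ?(ltW b0) //.
    by rewrite ler_nat cmono.
  have w_lt i j k : (i <= j <= n)%N -> (k <= M)%N -> (c k i < c k j)%N ->
      b ^+ k <= w j - w i.
    move=> ij kM ck; rewrite /w -sumrB.
    rewrite big_mkord (bigD1 (inord k)) //= inordK // -[leLHS]addr0 lerD //.
      rewrite -mulrBr -natrB; last exact: ltnW.
      rewrite ler_peMr ?exprn_ge0 ?(ltW b0) //.
      by rewrite ler1n subn_gt0.
    apply: sumr_ge0 => l _; rewrite -mulrBr mulr_ge0 ?exprn_ge0 ?(ltW b0) //.
    by rewrite subr_ge0 ler_nat cmono.
  have w_n : w n <= T.
    rewrite /T; apply: (@le_trans _ _ (4 * L ^+ 2 * (r / (1 - r) ^+ 2)));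
      last lra.
    apply: le_trans (ler_wpM2l _ (sum_arith_geometric M.+1 r01)); last first.
      by rewrite mulr_ge0 ?sqr_ge0.
    rewrite mulr_sumr; apply: ler_sum_nat => k /andP[_ kM].
    have ck := le_trans (_ : (c k n)%:R <= _) (max_changes_le k M L1 a1 NL).
    apply: le_trans (ler_wpM2l (exprn_ge0 k (ltW b0)) (ck _)) _.
      by rewrite ler_nat cn.
    rewrite rE [(b * _) ^+ k]exprMn; move: (b ^+ k) ((a ^+ 2) ^+ k) => u v.
    by rewrite le_eqVlt; apply/orP; left; apply/eqP; ring.
  have D0 : 0 <= K / 2 ^+ M by rewrite divr_ge0 // exprn_ge0.
  have [|||||i j ij||f [fH fd]] := step_param C0 ial0 (t := fun i => T^-1 * w i)
      (y := y) (n := n) (d := 2 * (K / 2 ^+ M)).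
  - by rewrite mulr_ge0.
  - by rewrite /w big1 ?mulr0 // => k _; rewrite c0 mulr0.
  - by rewrite ler_pdivrMl ?mulr1.
  - by move=> i j ij; rewrite ler_pM2l ?invr_gt0 // w_le.
  - exact: ystep.
  - case: (yd i j ij) => [yM|[k [kM ck yk]]].
      by rewrite (le_trans yM) // ler_wpDl ?mulr_ge0 ?powR_ge0 //; lra.
    rewrite (le_trans yk) // ler_wpDr ?mulr_ge0 // -mulrBr.
    have : (T^-1 * b ^+ k.+1) `^ al^-1 <= (T^-1 * (w j - w i)) `^ al^-1.
      apply: ge0_ler_powR; rewrite ?nnegrE ?mulr_ge0 ?invr_ge0 ?subr_ge0 ?w_le
        //;
        rewrite ?(ltW T0) ?(ltW al0) ?exprn_ge0 ?(ltW b0) //.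
      by rewrite ler_pM2l ?invr_gt0 // w_lt.
    move=> /(ler_wpM2l C0); apply: le_trans.
    rewrite powRM ?invr_ge0 ?exprn_ge0 ?(ltW T0) ?(ltW b0) // bk /C -(mulrA (24
      * K)).
    rewrite (mulrA (T `^ _)) -powRM ?invr_ge0 ?(ltW T0) // mulfV ?gt_eqF //.
    by rewrite powR1 mul1r exprS invfM; lra.
  - exact: ydense.
  exists f; split => [u v u0 uv v1|x].
    by apply: le_trans (fH u v u0 uv v1) _; rewrite lerD2l; lra.
  by have [u u01 ux] := fd x; exists u => //; lra.
exists f; split => //; exists (C + 1); first by rewrite ltr_wpDl.
move=> u v; rewrite /= !in_itv /= => /andP[u0 u1] /andP[v0 v1].
have P0 : 0 <= mdist (u : R^o) v `^ al^-1 by exact: powR_ge0.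
suff : mdist (f u) (f v) <= C * mdist (u : R^o) v `^ al^-1.
  by move=> h; apply: le_trans h _; rewrite ler_wpM2r // lerDl.
have -> : mdist (u : R^o) v = `|v - u| by [].
have [uv|/ltW vu] := leP u v; first by rewrite ger0_norm ?subr_ge0 // fH.
by rewrite metric_sym distrC ger0_norm ?subr_ge0 // fH.
Qed.

End HolderOfCovers.

(** * The S-dimension *)

Section SDimensionBounds.
Context {R : realType} {X : metricType R}.
Implicit Types (e d a s : R) (A : set X).

Lemma diameterP A e : 0 <= e ->
  (diameter A <= e%:E)%E <-> forall x y, A x -> A y -> mdist x y <= e.
Proof.
move=> e0; split => [Ae x y Ax Ay|Ae].
  rewrite -lee_fin (le_trans _ Ae) //; apply: ereal_sup_ubound; right.
  by exists (x, y).
apply: ge_ereal_sup => _ [->|[[x y] [/= Ax Ay] <-]]; rewrite lee_fin //.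
exact: Ae.
Qed.

Lemma closure_mdist_le A e : (forall x y, A x -> A y -> mdist x y <= e) ->
  forall x y, closure A x -> closure A y -> mdist x y <= e.
Proof.
move=> Ae x y cx cy; apply/ler_addgt0Pl => d d0.
have d2 : 0 < d / 2 by rewrite divr_gt0.
have [x' [Ax' xx']] := cx _ (nbhsx_ballx x _ d2).
have [y' [Ay' yy']] := cy _ (nbhsx_ballx y _ d2).
move: xx' yy' (Ae _ _ Ax' Ay'); rewrite !ballEmdist /=.
have := metric_triangle x x' y; have := metric_triangle x' y' y.
rewrite (metric_sym y' y); lra.
Qed.

Lemma S_number_le e (n : nat) (V : nat -> set X) : 0 <= e ->
  (forall i, connected (V i)) ->
  (forall i x y, V i x -> V i y -> mdist x y <= e) ->
  (forall x, exists2 i, (i < n)%N & V i x) ->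
  (S_number X e <= n%:R%:E)%E.
Proof.
move=> e0 cV dV VX; pose C := V @` `I_n.
have /finite_setP[m Cm] : finite_set C by exact/finite_image/finite_II.
have mn : (m <= n)%N.
  rewrite -card_le_II -(card_le_eql Cm); exact: card_image_le.
apply: (@le_trans _ _ m%:R%:E); last by rewrite lee_fin ler_nat.
apply: ereal_inf_lbound; exists m => //; exists C; split => //; split.
  apply/seteqP; split => // x _; have [i iN Vx] := VX x.
  by exists (V i) => //; exists i.
by move=> _ [i _ <-]; split => //; apply/(diameterP _ e0); exact: dV.
Qed.

(** Closures keep connectedness and diameter bounds, and empty or missing members of the cover are
    replaced by the point [x0]. *)
Lemma S_number_lt e a (x0 : X) : 0 <= e -> (S_number X e < a%:E)%E ->
  exists n (V : nat -> set X), n%:R < a /\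
    [/\ forall i, closed (V i), forall i, connected (V i),
        forall i, V i !=set0, forall x, exists2 i, (i < n)%N & V i x &
        forall i x y, V i x -> V i y -> mdist x y <= e].
Proof.
move=> e0 /ereal_inf_lt[_ [n [C [[CX CP] Cn]] <-]]; rewrite lte_fin => na.
have finC : finite_set C by apply/finite_setP; exists n.
pose W i := nth set0 (finmap.enum_fset (fset_set C)) i.
have szC := card_fset_set Cn.
have WC i : (i < n)%N -> C (W i).
  by move=> iN; have := mem_nth set0 (_ : (i < size (finmap.enum_fset (fset_set
    C)))%N);
    rewrite szC => /(_ iN); rewrite in_fset_set // inE.
pose B i := if `[< W i !=set0 >] then W i else [set x0].
have B_C i : (C (B i) \/ B i = [set x0]) /\ B i !=set0.
  rewrite /B; case: asboolP => [Wi|_]; last by split; [right|exists x0].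
  split => //; left; apply: WC; rewrite ltnNge; apply/negP => ni.
  by move: Wi; rewrite /W nth_default ?szC // => -[].
exists n, (fun i => closure (B i)); split => //; split.
- by move=> i; exact: closed_closure.
- move=> i; apply: connected_closure; case: (B_C i) => -[/CP[]//|-> _].
  exact: connected1.
- by move=> i; case: (B_C i) => _ [x Bx]; exists x; exact: subset_closure.
- move=> x; have : (\bigcup_(A in C) A) x by rewrite CX.
  case=> A CA Ax; have : A \in finmap.enum_fset (fset_set C).
    by rewrite in_fset_set // inE.
  move=> /(nthP set0)[i]; rewrite szC => iN WA; exists i => //.
  apply: subset_closure; rewrite /B; case: asboolP => [_|[]];
    first by rewrite /W WA.
  by exists x; rewrite /W WA.
- move=> i; apply: closure_mdist_le;
    case: (B_C i) => -[/CP[_ /(diameterP _ e0)]//|-> _].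
  by move=> x y -> ->; rewrite mdistxx.
Qed.

Lemma S_number_ge1 e (x0 : X) : (1 <= S_number X e)%E.
Proof.
apply: le_ereal_inf_tmp => _ [n [C [[CX _] Cn]] <-].
rewrite lee_fin ler1n lt0n; apply/eqP => n0; move: Cn; rewrite n0 II0 card_eq0.
move=> /eqP C0; have : (\bigcup_(A in C) A) x0 by rewrite CX.
by rewrite C0 => -[].
Qed.

Lemma ln_inv_gt0 e : 0 < e < 1 -> 0 < ln (1 / e).
Proof.
by move=> /andP[e0 e1]; rewrite div1r ln_gt0 // invf_gt1.
Qed.

Lemma S_dim_ge0 (x0 : X) : (0 <= S_dim X)%E.
Proof.
apply: le_ereal_inf_tmp => _ [V V0 <-].
have [e [[Ve /= e1] /= e0]] :
    exists e, (V e /\ e < 1) /\ 0 < e.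
  have [e He] := filter_ex
    (filterI (filterI V0 (nbhs_right_lt (@ltr01 R))) (nbhs_right_gt (0 : R))).
  by exists e.
apply: le_trans (_ : (_ <= lne (S_number X e) / (ln (1 / e))%:E)%E) _;
  last first.
  by apply: ereal_sup_ubound; exists e.
have l0 : 0 < ln (1 / e) by rewrite ln_inv_gt0 // e0.
by rewrite mule_ge0 ?inve_ge0 ?lee_fin ?(ltW l0) // lne_ge0 S_number_ge1.
Qed.

Lemma S_dim_lt s (x0 : X) : (S_dim X < s%:E)%E ->
  exists2 d, 0 < d &
    forall e, 0 < e < d -> (S_number X e < (e `^ (- s))%:E)%E.
Proof.
move=> /ereal_inf_lt[_ [V V0 <-] Vs].
have /nbhs_ballP[d /= d0 Vd] := V0.
exists (Num.min d 1); first by rewrite lt_min d0 /=.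
move=> e /andP[e0]; rewrite lt_min => /andP[ed e1].
have Ve : V e by apply: Vd => //=; rewrite /ball /= sub0r normrN gtr0_norm.
have l0 : 0 < ln (1 / e) by rewrite ln_inv_gt0 // e0.
have : (lne (S_number X e) / (ln (1 / e))%:E < s%:E)%E.
  by apply: le_lt_trans Vs; apply: ereal_sup_ubound; exists e.
have := S_number_ge1 e x0; case: (S_number X e) => [r| |] //; last first.
  by rewrite /= inver gt_eqF // gt0_mulye ?lte_fin ?invr_gt0.
rewrite lee_fin => r1; have r0 : 0 < r by lra.
rewrite lne_EFin // inver gt_eqF // lte_pdivrMr // -EFinM !lte_fin => lr.
by rewrite -ltr_ln ?posrE ?powR_gt0 // ln_powR mulNr -mulrN -lnV // -div1r.
Qed.

(** The constant [L] adds only [ln L / ln (1 / e)] to the quotient, which tends to 0; [t] below is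
    such that this is at most [h] for [e < t]. *)
Lemma S_dim_le a L d (x0 : X) : 1 <= L -> 0 < d ->
  (forall e, 0 < e < d -> (S_number X e <= (L * e `^ (- a))%:E)%E) ->
  (S_dim X <= a%:E)%E.
Proof.
move=> L1 d0 SL; apply/lee_addgt0Pr => h h0; rewrite -EFinD.
have lnL : 0 <= ln L by exact: ln_ge0.
pose t := Num.min d (Num.min 1 (expR (- (ln L / h)))).
have t0 : 0 < t by rewrite !lt_min d0 ltr01 expR_gt0.
apply: ereal_inf_le; exists (ereal_sup
  [set (lne (S_number X e) / (ln (1 / e))%:E)%E | e in [set e | e < t /\ 0 <
    e]]).
  exists [set e | e < t /\ 0 < e] => //.
  by apply: filterI; [exact: nbhs_right_lt|exact: nbhs_right_gt].
apply: ge_ereal_sup => _ [e [et e0] <-].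
move: et; rewrite !lt_min => /and3P[ed e1 eL].
have l0 : 0 < ln (1 / e) by rewrite ln_inv_gt0 // e0.
have := SL e; rewrite e0 ed => /(_ isT).
have := S_number_ge1 e x0; case: (S_number X e) => [r| |] //.
rewrite !lee_fin => r1 rL; have r0 : 0 < r by lra.
rewrite lne_EFin // inver gt_eqF // -EFinM lee_fin ler_pdivrMr //.
have lE : ln (1 / e) = - ln e by rewrite div1r lnV.
have : ln r <= ln L + a * ln (1 / e).
  rewrite lE mulrN -mulNr -ln_powR -lnM ?posrE ?powR_gt0 //; last by lra.
  by rewrite ler_ln ?posrE // mulr_gt0 ?powR_gt0 //; lra.
have : ln L <= h * ln (1 / e).
  rewrite -ler_pdivrMl // mulrC lE lerNr -ler_expR lnK // ltW //.
lra.
Qed.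

End SDimensionBounds.

(** * The two inequalities between the dimensions *)

Section Comparison.
Context {R : realType} {X : metricType R}.

Lemma holder_S_dim_le (f : R -> X) (a : R) : 0 < a ->
  holder_on (T := R^o) a^-1 `[0, 1] f -> set_surj `[0, 1] [set: X] f ->
  (S_dim X <= a%:E)%E.
Proof.
move=> a0 [C C0 fH] fS.
have ia0 : 0 < a^-1 by rewrite invr_gt0.
have dE (u v : R) : mdist (u : R^o) v = `|v - u| by [].
have cf : {within `[0, 1], continuous f}.
  apply/subspace_continuousP => u u01; apply/cvg_ballP => e e0.
  pose r := (e / 2 / C) `^ a.
  have e2C : 0 < e / 2 / C by rewrite !divr_gt0.
  have r0 : 0 < r by rewrite powR_gt0.
  rewrite near_withinE; apply: (filterS _ (nbhsx_ballx u _ r0)) => v.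
  rewrite /ball /= -dE metric_sym => /ltW uv v01;
    rewrite -/(ball (f u) e (f v)) ballEmdist /=.
  apply: le_lt_trans (fH u v u01 v01) _.
  apply: (@le_lt_trans _ _ (e / 2)); last by lra.
  rewrite mulrC -ler_pdivlMr //.
  have -> : e / 2 / C = r `^ a^-1 by rewrite /r -powRrM mulfV ?gt_eqF // powRr1
    ?ltW.
  apply: ge0_ler_powR; rewrite ?nnegrE ?(ltW ia0) ?(ltW r0) //.
  exact: mdist_ge0.
(* The cover below has [n.+1 <= y + 2] members, where [y] is the [a]-th power of [C / e]; as
   [e < 1], the 2 is absorbed by the power of [e]. *)
pose L := C `^ a + 2.
have L1 : 1 <= L by have := powR_ge0 C a; rewrite /L; lra.
have x0 := f 0.
apply: (S_dim_le x0 L1 ltr01) => e /andP[e0 e1].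
pose y := (C / e) `^ a; pose n := (Num.truncn y).+1.
have y0 : 0 <= y by exact: powR_ge0.
have yn : y <= n%:R by rewrite ltW // /n truncnS_gt.
have n0 : 0 < n%:R :> R by rewrite ltr0n.
have nL : n.+1%:R <= L * e `^ (- a).
  have : n%:R <= y + 1 by rewrite /n -natr1 lerD2r truncn_le.
  have : 1 <= e `^ (- a).
    by rewrite -[leLHS](powRr0 e) ger_powR ?e0 ?(ltW e1) // oppr_le0 ltW.
  have -> : y = C `^ a * e `^ (- a).
    by rewrite /y powRM ?invr_ge0 ?(ltW C0) ?(ltW e0) // -powR_inv1 ?ltW //
      -powRrM mulN1r.
  rewrite /L -natr1 mulrDl; lra.
(* The minimum keeps every [J i] inside the unit interval. [J n] reduces to the point 1, for which
   the truncation of [u * n] is [n]; hence [n.+1] intervals. *)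
pose J (i : nat) := `[i%:R / n%:R, Num.min 1 (i.+1%:R / n%:R) : R]%classic.
have I01 i : J i `<=` `[0, 1].
  move=> u; rewrite /J /= !in_itv /= le_min => /and3P[u1 u2 _].
  by rewrite u2 andbT (le_trans _ u1) // divr_ge0.
apply: (@le_trans _ _ n.+1%:R%:E); last by rewrite lee_fin.
apply: (@S_number_le _ _ _ _ (fun i => f @` J i)); first exact: ltW.
- move=> i; apply: connected_continuous_connected;
    first exact: segment_connected.
  exact: continuous_subspaceW (I01 i) cf.
- move=> i _ _ [u Iu <-] [v Iv <-].
  apply: le_trans (fH u v (I01 i u Iu) (I01 i v Iv)) _.
  have uvn : `|v - u| <= n%:R^-1.
    move: Iu Iv; rewrite /J /= !in_itv /= !le_min -natr1 mulrDl mul1r.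
    move=> /and3P[u1 _ u2] /and3P[v1 _ v2]; rewrite ler_norml; lra.
  rewrite dE mulrC -ler_pdivlMr //.
  have -> : e / C = ((C / e) `^ (- a)) `^ a^-1.
    by rewrite -powRrM mulNr mulfV ?gt_eqF // powR_inv1 ?invf_div // divr_ge0
      ?ltW.
  apply: ge0_ler_powR; rewrite ?nnegrE ?(ltW ia0) ?powR_ge0 //.
  apply: le_trans uvn _; rewrite powRN lef_pV2 ?posrE // powR_gt0 //.
  by rewrite divr_gt0.
- move=> x; have [u u01 <-] := fS x I.
  move: u01 => /=; rewrite in_itv /= => /andP[u0 u1].
  have un0 : 0 <= u * n%:R by rewrite mulr_ge0 // ltW.
  exists (Num.truncn (u * n%:R)).
    rewrite ltnS -(@ler_nat R); apply: (@le_trans _ _ (u * n%:R)).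
      by rewrite truncn_le.
    by apply: ler_piMl => //; exact: ltW.
  exists u => //; rewrite /J /= in_itv /= le_min u1 /=.
  rewrite ler_pdivrMr // truncn_le un0 ler_pdivlMr //=.
  exact/ltW/truncnS_gt.
Qed.

(** Provides the diameter bound for the whole space, which serves as the only set of level 0. *)
Lemma mdist_bounded (e : R) (n : nat) (V : nat -> set X) (x0 : X) :
  (forall i, V i !=set0) -> (forall x, exists2 i, (i < n)%N & V i x) ->
  (forall i x y, V i x -> V i y -> mdist x y <= e) ->
  exists K : R, forall x y : X, mdist x y <= K.
Proof.
move=> V0 VX Ve.
pose c i := sval (cid (V0 i)).
have Vc i : V i (c i) by rewrite /c; case: cid.
pose K := \sum_(i < n) mdist x0 (c i) + e.
have bnd x : mdist x0 x <= K.
  have [i iN Vx] := VX x; apply: le_trans (metric_triangle _ (c i) _) _.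
  apply: lerD; last exact: Ve (Vc i) Vx.
  rewrite (bigD1 (Ordinal iN)) //= lerDl.
  by apply: sumr_ge0 => j _; exact: mdist_ge0.
exists (K + K) => x y; apply: le_trans (metric_triangle _ x0 _) _.
by rewrite lerD // metric_sym.
Qed.

Lemma holder_param_exists (al : R) : peano_continuum R X ->
  (2%:E * S_dim X < al%:E)%E ->
  exists f : R -> X, holder_on (T := R^o) al^-1 `[0, 1] f /\
    set_surj `[0, 1] [set: X] f.
Proof.
move=> [_ [phi [cphi phiS]]] Sal.
have x0 := phi 0.
have fX : phi @` `[0, 1] = [set: X] by apply/seteqP; split => // x /phiS.
have cX : compact [set: X].
  by rewrite -fX; exact: continuous_compact cphi (@segment_compact R 0 1).
have conX : connected [set: X].
  rewrite -fX; apply: connected_continuous_connected cphi.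
  exact: segment_connected.
(* For a finite S-dimension, [s] is the midpoint between it and [al / 2]; the value [+oo]
   contradicts [Sal]. *)
have [s s0 [sal Ss]] : exists2 s : R, 0 <= s & 2 * s < al /\ (S_dim X < s%:E)%E.
  have := S_dim_ge0 x0; move: Sal; case: (S_dim X) => [r| |] //.
    rewrite -EFinM !lte_fin lee_fin => ra r0; exists ((r + al / 2) / 2);
      first lra.
    by rewrite lte_fin; split; lra.
  by rewrite gt0_muley ?lte_fin.
have [d d0 Sd] := S_dim_lt x0 Ss.
pose e0 := Num.min d 1 / 2.
have e00 : 0 < e0 by rewrite /e0 divr_gt0 // lt_min d0 /=.
have [e0d e01] : e0 < d /\ e0 <= 1.
  have := ge_min d d 1; have := ge_min 1 d 1; rewrite !lexx orbT /= /e0.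
  by move=> h1 h2; split; lra.
pose e k : R := e0 / 2 ^+ k.
have ek k : 0 < e k < d.
  rewrite /e divr_gt0 ?exprn_gt0 //= (le_lt_trans _ e0d) //.
  apply: ler_piMr; first exact: ltW.
  by rewrite invf_le1 ?exprn_gt0 // exprn_ege1 // ler1n.
have cov k := @S_number_lt R X (e k) _ x0 (ltW (proj1 (andP (ek k)))) (Sd _ (ek
  k)).
have [n /choice[V nV]] := choice cov.
have nP k : (n k)%:R < e k `^ (- s) by case: (nV k).
have Vcl k i : closed (V k i) by case: (nV k) => _ [].
have Vco k i : connected (V k i) by case: (nV k) => _ [].
have Vne k i : V k i !=set0 by case: (nV k) => _ [].
have Vcov k x : exists2 i, (i < n k)%N & V k i x by case: (nV k) => _ [].
have Vd k i x y : V k i x -> V k i y -> mdist x y <= e k.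
  by case: (nV k) => _ [_ _ _ _]; apply.
have [K0 K0P] := mdist_bounded x0 (Vne 0%N) (Vcov 0%N) (Vd 0%N).
(* Level 0 is replaced by the single set [X], so that labels of level 0 never change. *)
pose N k := if k is 0%N then 1%N else n k.
pose U k := if k is 0%N then (fun=> [set: X]) else V k.
pose K := Num.max K0 e0; pose L := Num.max 1 (e0 `^ (- s)).
apply: (@holder_of_covers R X N U K L s al) => //.
- by move=> [|k] i; [exact: closedT|exact: Vcl].
- by move=> [|k] i; [exact: conX|exact: Vco].
- by move=> [|k] i; [exists x0|exact: Vne].
- by move=> [|k] x; [exists 0%N|exact: Vcov].
- move=> [|k] i x y Ux Uy; first by rewrite expr0 divr1 le_max K0P.
  apply: le_trans (Vd _ _ _ _ Ux Uy) _;
    rewrite /e ler_pM2r ?invr_gt0 ?exprn_gt0 //.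
  by rewrite le_max lexx orbT.
- by rewrite le_max lexx.
- move=> [|k]; first by rewrite expr0 mulr1 le_max lexx.
  apply: le_trans (ltW (nP _)) _;
    rewrite /e powRM ?invr_ge0 ?exprn_ge0 ?(ltW e00) //.
  have -> : (2 ^+ k.+1)^-1 `^ (- s) = (2 `^ s) ^+ k.+1.
    rewrite -!powR_mulrn ?powR_ge0 // -powRN -!powRrM; congr (_ `^ _); ring.
  by rewrite ler_wpM2r ?exprn_ge0 ?powR_ge0 // le_max lexx orbT.
Qed.

End Comparison.

Theorem corollary1p2 (R : realType) (X : metricType R)
    (hX : peano_continuum R X) :
  (S_dim X <= holder_dim X)%E /\ (holder_dim X <= 2%:E * S_dim X)%E.
Proof.
split.
  apply: le_ereal_inf_tmp => -[a| |] [a0 [f [fH fS]]] //; last by rewrite leey.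
  move: a0 fH; rewrite lte_fin => a0.
  by rewrite fine_invr => fH; exact: holder_S_dim_le a0 fH fS.
have [_ [phi _]] := hX; have := S_dim_ge0 (phi 0).
case E : (S_dim X) => [s| |] // s0; last by rewrite gt0_muley ?leey ?lte_fin.
(* Every exponent [2 * s + h] with [h > 0] is admissible; [h] also makes it positive when
   [s = 0]. *)
apply/lee_addgt0Pr => h h0; rewrite -EFinM -EFinD.
rewrite lee_fin in s0; apply: ereal_inf_lbound; split;
  first by rewrite lte_fin; lra.
rewrite fine_invr; apply: holder_param_exists => //.
by rewrite E -EFinM lte_fin ltrDl.
Qed.
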